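(* Let $P$ be a minuscule poset. Then $\sum_{p\in P}T_p^-\equiv^q \frac{\sum_{p\in P}q^{\mathrm{rk}(p)}}{[\mathrm{rk}(P)+2]_q}$.
   Context: Minuscule posets are the posets attached to a Dynkin diagram with a minuscule node; up to isomorphism they are: rectangles $[a]\times[b]$ (product order); shifted staircases $\{(i,j)\colon1\le i\le j\le n\}$ with componentwise order; double-tailed diamonds $d_n(1)$ ($n\ge2$): a chain $x_1<\dots<x_{n-1}$, two incomparable $y_1,y_2$, a chain $z_{n-1}<\dots<z_1$, with $x_i<y_j<z_k$ for all $i,j,k$; and the exceptional minuscule posets $\Lambda_{E_6}$ and $\Lambda_{E_7}$ of types $E_6,E_7$. They are graded; $\mathrm{rk}$ is the rank function with minimal elements of rank $0$ and $\mathrm{rk}(P)$ is the maximum rank. $\mathcal{J}(P)$ is the set of order ideals. For $p\in P$, $I\in\mathcal{J}(P)$: $T_p^+(I)=1$ if $p$ is minimal in $P\setminus I$, else $0$; $T_p^-(I)=1$ if $p$ is maximal in $I$, else $0$; $T_p^q=T_p^+-qT_p^-$ with $q$ an indeterminate. $f\equiv^q g$ means $f-g=\sum_{p\in P}c_p(q)T_p^q$ for some $c_p(q)\in\mathbb{R}(q)$; an element of $\mathbb{R}(q)$ denotes a constant function. $[m]_q=1+q+\dots+q^{m-1}$. *)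

(* Defs.v *)
From HB Require Import structures.
From mathcomp Require Import all_boot all_order all_algebra.
From mathcomp Require Import fraction Rstruct.
From Stdlib Require Import Rdefinitions.
Set Implicit Arguments. Unset Strict Implicit. Unset Printing Implicit Defensive.
Import Order.TTheory GRing.Theory Num.Theory.

Definition lt_of (T : finType) (le : rel T) (x y : T) : bool := (x != y) && le x y.

Definition order_iso (T U : finType) (le : rel T) (leU : rel U) : Prop :=
  exists f : T -> U, bijective f /\ forall x y, le x y = leU (f x) (f y).

Definition rect_le (a b : nat) : rel ('I_a * 'I_b) :=
  fun x y => (x.1 <= y.1)%N && (x.2 <= y.2)%N.

(* shifted staircase {(i,j) : 1 <= i <= j <= n}, componentwise order
   (encoded 0-based) *)
Definition stair_T (n : nat) := {x : 'I_n * 'I_n | (x.1 <= x.2)%N}.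
Definition stair_le (n : nat) : rel (stair_T n) :=
  fun x y => ((val x).1 <= (val y).1)%N && ((val x).2 <= (val y).2)%N.

(* double-tailed diamond d_n(1) on 'I_(2n):
   0..n-2 are x_1<..<x_{n-1}; n-1 and n are y_1,y_2; n+1..2n-1 are
   z_{n-1}<..<z_1.  Elements are compared by index, except y_1, y_2. *)
Definition dtd_le (n : nat) : rel 'I_(2 * n) :=
  fun a b => (a == b) || ((a < b)%N && ~~ ((a == n.-1 :> nat) && (b == n :> nat))).

(* Exceptional minuscule posets: positive roots having coefficient 1 at the
   minuscule simple root (E6: node 1, E7: node 7, Bourbaki labelling), with the
   root order (componentwise comparison of simple-root coordinates). *)
Definition E6_roots : seq (seq nat) :=
 [:: [:: 1;0;0;0;0;0]; [:: 1;0;1;0;0;0]; [:: 1;0;1;1;0;0]; [:: 1;0;1;1;1;0];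
     [:: 1;1;1;1;0;0]; [:: 1;0;1;1;1;1]; [:: 1;1;1;1;1;0]; [:: 1;1;1;1;1;1];
     [:: 1;1;1;2;1;0]; [:: 1;1;1;2;1;1]; [:: 1;1;2;2;1;0]; [:: 1;1;1;2;2;1];
     [:: 1;1;2;2;1;1]; [:: 1;1;2;2;2;1]; [:: 1;1;2;3;2;1]; [:: 1;2;2;3;2;1]].

Definition E7_roots : seq (seq nat) :=
 [:: [:: 0;0;0;0;0;0;1]; [:: 0;0;0;0;0;1;1]; [:: 0;0;0;0;1;1;1];
     [:: 0;0;0;1;1;1;1]; [:: 0;0;1;1;1;1;1]; [:: 0;1;0;1;1;1;1];
     [:: 0;1;1;1;1;1;1]; [:: 1;0;1;1;1;1;1]; [:: 0;1;1;2;1;1;1];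
     [:: 1;1;1;1;1;1;1]; [:: 0;1;1;2;2;1;1]; [:: 1;1;1;2;1;1;1];
     [:: 0;1;1;2;2;2;1]; [:: 1;1;1;2;2;1;1]; [:: 1;1;2;2;1;1;1];
     [:: 1;1;1;2;2;2;1]; [:: 1;1;2;2;2;1;1]; [:: 1;1;2;2;2;2;1];
     [:: 1;1;2;3;2;1;1]; [:: 1;1;2;3;2;2;1]; [:: 1;2;2;3;2;1;1];
     [:: 1;1;2;3;3;2;1]; [:: 1;2;2;3;2;2;1]; [:: 1;2;2;3;3;2;1];
     [:: 1;2;2;4;3;2;1]; [:: 1;2;3;4;3;2;1]; [:: 2;2;3;4;3;2;1]].

Definition root_le (rs : seq (seq nat)) (n : nat) : rel 'I_n :=
  fun i j => all2 leq (nth [::] rs i) (nth [::] rs j).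

Definition E6_le : rel 'I_16 := @root_le E6_roots 16.
Definition E7_le : rel 'I_27 := @root_le E7_roots 27.

Definition minuscule (T : finType) (le : rel T) : Prop :=
     (exists a b, [/\ (0 < a)%N, (0 < b)%N & order_iso le (@rect_le a b)])
  \/ (exists n, (0 < n)%N /\ order_iso le (@stair_le n))
  \/ (exists n, (2 <= n)%N /\ order_iso le (@dtd_le n))
  \/ order_iso le E6_le
  \/ order_iso le E7_le.

(* height_fuel k p = length of a longest chain x_0 < ... < x_m = p (capped by k);
   with fuel #|T| this is the exact maximal chain length, i.e. the rank in a
   graded poset (minimal elements have rank 0). *)
Fixpoint height_fuel (T : finType) (le : rel T) (k : nat) (p : T) : nat :=
  if k is k'.+1 then \max_(x | lt_of le x p) (height_fuel le k' x).+1 else 0.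

Definition rk (T : finType) (le : rel T) (p : T) : nat := height_fuel le #|T| p.
Definition rkP (T : finType) (le : rel T) : nat := \max_(p : T) rk le p.

Definition order_ideal (T : finType) (le : rel T) (I : {set T}) : bool :=
  [forall x, forall y, (le x y && (y \in I)) ==> (x \in I)].

Definition Tplus_b (T : finType) (le : rel T) (I : {set T}) (p : T) : bool :=
  (p \notin I) && [forall x, lt_of le x p ==> (x \in I)].
Definition Tminus_b (T : finType) (le : rel T) (I : {set T}) (p : T) : bool :=
  (p \in I) && [forall x, lt_of le p x ==> (x \notin I)].

Local Open Scope ring_scope.

Notation Rq := {fraction {poly R}}.
Definition qvar : Rq := @FracField.tofrac {poly R} 'X.

Definition Tplus (T : finType) (le : rel T) (p : T) (I : {set T}) : Rq :=
  (Tplus_b le I p)%:R.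
Definition Tminus (T : finType) (le : rel T) (p : T) (I : {set T}) : Rq :=
  (Tminus_b le I p)%:R.
Definition Tq (T : finType) (le : rel T) (p : T) (I : {set T}) : Rq :=
  Tplus le p I - qvar * Tminus le p I.

Definition qequiv (T : finType) (le : rel T) (f g : {set T} -> Rq) : Prop :=
  exists c : T -> Rq, forall I : {set T}, order_ideal le I ->
    f I - g I = \sum_(p : T) c p * Tq le p I.

Definition qint (m : nat) : Rq := \sum_(i < m) qvar ^+ i.

(* Main.v *)
(* Writing T_p^q = T_p^+ - q T_p^-, the claim asks for weights c_p such that
   sum_p (c_p T_p^+(I) - (1 + q c_p) T_p^-(I)) takes the same value -rho on all
   order ideals I, with rho the stated constant.
   For a rectangle, c_(i,j) = f(i) + g(j) with f(i+1) = q f(i) and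
   g(j+1) = q g(j) + 1: then 1 + q c_(i,j) = f(i+1) + g(j+1), so the sum is taken
   over the turns of the boundary path of I with a weight that splits into a row
   part and a column part, and both telescope; the boundary values f(0) + g(b) and
   f(a) + g(0) are chosen to vanish.
   An ideal of the shifted staircase unfolds to a symmetric ideal of the square;
   weights f(i) + f(j) with f(i+1) = q f(i) + 1/2 work up to a constant correction on the
   diagonal, where exactly one cell is addable or removable.
   For double-tailed diamonds the weights are found by solving along the two
   chains; for E6 and E7 they are given explicitly and checked on all the 27,
   resp. 56, order ideals. *)
Require Import Defs.
From mathcomp Require Import all_boot all_order all_algebra.
From mathcomp Require Import fraction Rstruct ring zify.
Import GRing.Theory Num.Theory.
Local Open Scope ring_scope.

(** * Rank functions and nonvanishing in $\mathbb{R}(q)$ *)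

Definition is_rank {T : finType} (le : rel T) (r : T -> nat) : Prop :=
  (forall x y, lt_of le x y -> (r x < r y)%N) /\
  (forall y, (0 < r y)%N -> exists2 x, lt_of le x y & (r x).+1 = r y).

(** Descending from [p] one level at a time meets every value from [r p] down to 0, so [T] has at
    least [r p + 1] elements. Hence the fuel [#|T|] in [rk] never truncates. *)
Lemma is_rank_lt_card {T : finType} {le : rel T} {r : T -> nat} p :
  is_rank le r -> (r p < #|T|)%N.
Proof.
move=> [_ rS].
have surj d : (d <= r p)%N -> exists x, r x = (r p - d)%N.
  elim: d => [_|d IHd dp]; first by exists p; rewrite subn0.
  have [x rx] := IHd (ltnW dp).
  have [|y _ ry] := rS x; first by rewrite rx subn_gt0.
  by exists y; apply: succn_inj; rewrite ry rx subnSK.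
rewrite cardE -(size_map r) -(size_iota 0 (r p).+1).
apply: uniq_leq_size; first exact: iota_uniq.
move=> k; rewrite mem_iota /= add0n ltnS => kp.
have [x] := surj (r p - k)%N (leq_subr _ _).
by rewrite subKn // => <-; rewrite map_f // mem_enum.
Qed.

Lemma rk_is_rank {T : finType} {le : rel T} {r : T -> nat} :
  is_rank le r -> rk le =1 r.
Proof.
move=> rP p; have [rlt rS] := rP.
(* Strict increase of [r] bounds every chain, and the descent property attains the bound; with fuel
   [k] the height is merely cut off at [k]. *)
suff hk k q : height_fuel le k q = minn k (r q).
  by rewrite /rk hk (minn_idPr (ltnW (is_rank_lt_card p rP))).
elim: k q => [|k IHk] q /=; first by rewrite min0n.
apply/eqP; rewrite eqn_leq; apply/andP; split.
  apply/bigmax_leqP => x /rlt xq; rewrite IHk.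
  by rewrite leq_min ltnS geq_minl (leq_ltn_trans (geq_minr _ _)).
have [->|rq0] := posnP (r q); first by rewrite minn0.
have [x xq rx] := rS q rq0.
by rewrite (bigD1 x) //= IHk -rx minnSS leq_max leqnn.
Qed.

(** Every denominator below is a polynomial in $q$ with nonzero constant term, so evaluation at 0
    suffices. *)
Lemma qvar_poly_neq0 (p : {poly Rdefinitions.R}) : p.[0] != 0 -> tofrac p != 0.
Proof. by rewrite tofrac_eq0; apply: contraNneq => ->; rewrite horner0. Qed.

Lemma geom_sum (K : comRingType) (q : K) n :
  (1 - q) * (\sum_(i < n) q ^+ i) = 1 - q ^+ n.
Proof. by rewrite -opprB mulNr -subrX1 opprB. Qed.

Lemma qvarB1_neq0 n : (0 < n)%N -> 1 - qvar ^+ n != 0.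
Proof.
move=> n0; rewrite -rmorphXn -(rmorph1 (@tofrac _)) -rmorphB.
by apply: qvar_poly_neq0; rewrite !hornerE expr0n eqn0Ngt n0 subr0 oner_neq0.
Qed.

Lemma qvarD1_neq0 n : (0 < n)%N -> 1 + qvar ^+ n != 0.
Proof.
move=> n0; rewrite -rmorphXn -(rmorph1 (@tofrac _)) -rmorphD.
by apply: qvar_poly_neq0; rewrite !hornerE expr0n eqn0Ngt n0 addr0 oner_neq0.
Qed.

Lemma qint_neq0 n : (0 < n)%N -> qint n != 0.
Proof.
move=> n0; have := qvarB1_neq0 n n0; rewrite -geom_sum.
by apply: contraNneq => qn0; rewrite -/(qint n) qn0 mulr0.
Qed.

Definition antichain_qconstant {T : finType} (le : rel T) : Prop :=
  qequiv le (fun I => \sum_(p : T) Tminus le p I)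
            (fun _ => (\sum_(p : T) qvar ^+ rk le p) / qint (rkP le + 2)).

(** Reduces each family to a rank function, a choice of weights and two identities. The constant
    [rho] is characterized by a product, so that the division by the $q$-integer is handled only
    here. *)
Lemma qequiv_criterion {T : finType} {le : rel T} (r : T -> nat) (N : nat)
    (c : T -> Rq) (rho : Rq) :
  is_rank le r -> (forall p, (r p <= N)%N) -> (exists p, r p = N) ->
  rho * qint (N + 2) = \sum_p qvar ^+ r p ->
  (forall I, order_ideal le I ->
    \sum_p (c p * (Tplus_b le I p)%:R
            - (1 + qvar * c p) * (Tminus_b le I p)%:R) = - rho) ->
  antichain_qconstant le.
Proof.
move=> rP rN [p0 rp0] rhoE cP; exists c => I idI.
have -> : rkP le = N.
  apply/eqP; rewrite eqn_leq; apply/andP; split.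
    by apply/bigmax_leqP => p _; rewrite (rk_is_rank rP).
  by rewrite /rkP (bigD1 p0) //= (rk_is_rank rP) rp0 leq_max leqnn.
under [X in X / _]eq_bigr => p _ do rewrite (rk_is_rank rP).
rewrite -rhoE mulfK; last by rewrite qint_neq0 // addn2.
rewrite -(cP I idI) -big_split /=; apply: eq_bigr => p _.
rewrite /Tq /Tplus /Tminus; ring.
Qed.

(** * Invariance under order isomorphism *)

Section Transport.
Context {T U : finType} {le : rel T} {leU : rel U} (f : T -> U).
Hypotheses (f_bij : bijective f) (f_mono : forall x y, le x y = leU (f x) (f y)).

Let f_inj : injective f := bij_inj f_bij.

Let lt_f x y : lt_of le x y = lt_of leU (f x) (f y).
Proof. by rewrite /lt_of f_mono inj_eq. Qed.

Let forall_f (P : pred U) : [forall y, P y] = [forall x, P (f x)].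
Proof.
apply/forallP/forallP => [h x|h y]; first exact: h.
by have [g _ gK] := f_bij; rewrite -(gK y).
Qed.

Let sum_f (R : nmodType) (F : U -> R) : \sum_(y : U) F y = \sum_(x : T) F (f x).
Proof. by rewrite (reindex f) //; apply: onW_bij. Qed.

Let max_f (P : pred U) (F : U -> nat) : (\max_(y | P y) F y = \max_(x | P (f x)) F (f x))%N.
Proof. by rewrite (reindex f) //; apply: onW_bij. Qed.

Let height_f k p : height_fuel le k p = height_fuel leU k (f p).
Proof.
elim: k p => //= k IHk p; rewrite max_f.
by apply: eq_big => [x|x _]; rewrite ?lt_f ?IHk.
Qed.

Let rk_f p : rk le p = rk leU (f p).
Proof. by rewrite /rk height_f (bij_eq_card f_bij). Qed.

Let rkP_f : rkP le = rkP leU.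
Proof. by rewrite /rkP max_f; apply: eq_bigr => x _; rewrite rk_f. Qed.

Lemma antichain_qconstant_iso : antichain_qconstant leU -> antichain_qconstant le.
Proof.
move=> [c cP]; exists (c \o f) => I idI.
have memf x : (f x \in f @: I) = (x \in I) by rewrite mem_imset.
have Tp p : Tplus_b leU (f @: I) (f p) = Tplus_b le I p.
  rewrite /Tplus_b memf forall_f; congr andb; apply: eq_forallb => x.
  by rewrite memf lt_f.
have Tm p : Tminus_b leU (f @: I) (f p) = Tminus_b le I p.
  rewrite /Tminus_b memf forall_f; congr andb; apply: eq_forallb => x.
  by rewrite memf lt_f.
have idfI : order_ideal leU (f @: I).
  rewrite /order_ideal forall_f; apply/forallP => x; rewrite forall_f.
  apply/forallP => y; rewrite !memf -f_mono.
  exact: (forallP (forallP idI x) y).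
have rksum : \sum_(y : U) qvar ^+ rk leU y = \sum_(x : T) qvar ^+ rk le x.
  by rewrite sum_f; apply: eq_bigr => x _; rewrite rk_f.
have := cP _ idfI; rewrite rksum !sum_f -rkP_f /Tq /Tplus /Tminus.
under eq_bigr do rewrite Tm.
by move=> ->; apply: eq_bigr => p _; rewrite Tp Tm.
Qed.

End Transport.

(** * Rectangles *)

(** On a lower set only the immediate neighbours matter. The tests at 0 are required because [0.-1]
    is [0]. *)
Definition add_corner (m : rel nat) i j :=
  [&& ~~ m i j, (i == 0%N) || m i.-1 j & (j == 0%N) || m i j.-1].
Definition rem_corner (m : rel nat) i j :=
  [&& m i j, ~~ m i.+1 j & ~~ m i j.+1].

Section Corners.
Context {K : comRingType} (m : rel nat).
Hypothesis m_lower : forall i j i' j',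
  (i' <= i)%N -> (j' <= j)%N -> m i j -> m i' j'.

(** Row [i.+1] has an addable cell exactly when it is shorter than row [i], which is exactly when
    row [i] has a removable cell; each row has at most one of either kind. *)
Lemma row_corners i b : ~~ m i b ->
  \sum_(0 <= j < b) (add_corner m i.+1 j)%:R
  = \sum_(0 <= j < b) (rem_corner m i j)%:R :> K.
Proof.
move=> mib; apply/eqP; rewrite -subr_eq0 -sumrB.
(* [v] marks the columns strictly after the addable cell of row [i.+1], up to the removable cell of
   row [i], so its increments are the difference of the two indicators. *)
pose v j : K := (m i j && ~~ ((j == 0%N) || m i.+1 j.-1))%:R.
rewrite (eq_bigr (fun j => v j.+1 - v j)) => [|j _].
  by rewrite telescope_sumr // /v (negbTE mib) /= andbF subrr.
rewrite /v /add_corner /rem_corner /=.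
have h1 := m_lower i.+1 j i j (leqnSn i) (leqnn j).
have h2 := m_lower i j.+1 i j (leqnn i) (leqnSn j).
have h3 := m_lower i.+1 j i.+1 j.-1 (leqnn _) (leq_pred j).
move: h1 h2 h3.
case: (m i j); case: (m i.+1 j); case: (m i j.+1); case: (j == 0%N);
  case: (m i.+1 j.-1) => //= h1 h2 h3; rewrite ?subrr ?subr0 ?sub0r //;
  by [have := h1 isT|have := h2 isT|have := h3 isT].
Qed.

Lemma first_row_corners b :
  \sum_(0 <= j < b.+1) (add_corner m 0 j)%:R = 1 - (m 0%N b)%:R :> K.
Proof.
pose w j : K := - ((j == 0%N) || m 0%N j.-1)%:R.
rewrite (eq_bigr (fun j => w j.+1 - w j)) => [|j _].
  by rewrite telescope_sumr // /w /= opprK addrC.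
rewrite /w /add_corner /=; have := m_lower 0%N j 0%N j.-1 (leqnn _) (leq_pred j).
case: (m 0%N j); case: (j == 0%N); case: (m 0%N j.-1) => //= h;
  rewrite ?opprK ?addNr ?addr0 ?oppr0 ?add0r //; by have := h isT.
Qed.

Lemma last_row_corners a b : (forall j, ~~ m a.+1 j) -> ~~ m a b ->
  \sum_(0 <= j < b) (rem_corner m a j)%:R = (m a 0%N)%:R :> K.
Proof.
move=> ma mb; pose w j : K := - (m a j)%:R.
rewrite (eq_bigr (fun j => w j.+1 - w j)) => [|j _].
  by rewrite telescope_sumr // /w (negbTE mb) oppr0 opprK add0r.
rewrite /w /rem_corner (negbTE (ma j)) /=.
have := m_lower a j.+1 a j (leqnn _) (leqnSn j).
case: (m a j); case: (m a j.+1) => //= h;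
  rewrite ?opprK ?addNr ?addr0 ?oppr0 ?add0r //; by have := h isT.
Qed.

(** The addable cell of row [i.+1] and the removable cell of row [i] carry the same weight [f i.+1]
    and cancel by [row_corners]; only the addable cell of the first row and the removable cell of
    the last row survive. *)
Lemma weighted_row_corners (f : nat -> K) a b :
    (forall j, ~~ m a.+1 j) -> (forall i, ~~ m i b.+1) ->
  \sum_(0 <= i < a.+1) \sum_(0 <= j < b.+1)
     (f i * (add_corner m i j)%:R - f i.+1 * (rem_corner m i j)%:R)
  = f 0%N * (1 - (m 0%N b)%:R) - f a.+1 * (m a 0%N)%:R.
Proof.
move=> ma mb.
under eq_bigr do rewrite sumrB -!mulr_sumr.
rewrite sumrB big_nat_recl //= [X in _ - X]big_nat_recr //=.
rewrite first_row_corners (last_row_corners a) //.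
under eq_bigr do rewrite row_corners //.
ring.
Qed.

End Corners.

(* The boundary conditions on f and g make the weights vanish at the two ends of
   the boundary path of m, so that row and column contributions cancel. *)
Lemma weighted_corners {K : comRingType} (m : rel nat) (f g : nat -> K) a b :
    (forall i j i' j', (i' <= i)%N -> (j' <= j)%N -> m i j -> m i' j') ->
    (forall j, ~~ m a.+1 j) -> (forall i, ~~ m i b.+1) ->
    f 0%N + g b.+1 = 0 -> f a.+1 + g 0%N = 0 ->
  \sum_(0 <= i < a.+1) \sum_(0 <= j < b.+1)
     ((f i + g j) * (add_corner m i j)%:R
      - (f i.+1 + g j.+1) * (rem_corner m i j)%:R)
  = f 0%N + g 0%N.
Proof.
move=> m_lower ma mb /eqP; rewrite addrC addr_eq0 => /eqP gb /eqP.
rewrite addr_eq0 => /eqP fa.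
have addT i j : add_corner (fun x y => m y x) i j = add_corner m j i.
  by rewrite /add_corner [X in _ && X]andbC.
have remT i j : rem_corner (fun x y => m y x) i j = rem_corner m j i.
  by rewrite /rem_corner [X in _ && X]andbC.
have rows := weighted_row_corners m m_lower f a b ma mb.
have cols := weighted_row_corners (fun x y => m y x)
  (fun i j i' j' ii jj => m_lower j i j' i' jj ii) g b a mb ma.
rewrite exchange_big /= in cols.
rewrite (eq_bigr (fun i =>
  \sum_(0 <= j < b.+1)
     (f i * (add_corner m i j)%:R - f i.+1 * (rem_corner m i j)%:R) +
  \sum_(0 <= j < b.+1)
     (g j * (add_corner m i j)%:R - g j.+1 * (rem_corner m i j)%:R))); last first.
  move=> i _; rewrite -big_split /=; apply: eq_bigr => j _; ring.
rewrite big_split /= rows.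
under eq_bigr => i _ do under eq_bigr => j _ do rewrite -addT -remT.
by rewrite cols fa gb; ring.
Qed.

(** Membership is extended by [false] outside the box, so that corners can be tested by looking one
    cell beyond it. *)
Definition cells {a b : nat} (I : {set 'I_a * 'I_b}) : rel nat := fun i j =>
  [exists p : 'I_a * 'I_b, [&& p \in I, p.1 == i :> nat & p.2 == j :> nat]].

Lemma cellsP {a b : nat} (I : {set 'I_a * 'I_b}) i j :
  reflect (exists p : 'I_a * 'I_b, [/\ p \in I, nat_of_ord p.1 = i & nat_of_ord p.2 = j])
          (cells I i j).
Proof.
apply: (iffP existsP) => [[p /and3P[pI /eqP pi /eqP pj]]|[p [pI pi pj]]];
  by exists p => //; rewrite pI pi pj !eqxx.
Qed.

Lemma cells_mem {a b : nat} (I : {set 'I_a * 'I_b}) (p : 'I_a * 'I_b) :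
  cells I p.1 p.2 = (p \in I).
Proof.
apply/cellsP/idP => [[[x y] [+ /val_inj /= xp /val_inj /= yp]]|pI].
  by rewrite xp yp; case: p {xp yp}.
by exists p.
Qed.

Lemma cells_lower {a b : nat} (I : {set 'I_a * 'I_b}) :
  order_ideal (@rect_le a b) I -> forall i j i' j',
  (i' <= i)%N -> (j' <= j)%N -> cells I i j -> cells I i' j'.
Proof.
move=> idI i j i' j' ii jj /cellsP[p [pI pi pj]].
have ia : (i' < a)%N by rewrite (leq_ltn_trans ii) // -pi.
have jb : (j' < b)%N by rewrite (leq_ltn_trans jj) // -pj.
apply/cellsP; exists (Ordinal ia, Ordinal jb); split=> //.
have /forallP/(_ p)/implyP := forallP idI (Ordinal ia, Ordinal jb).
by apply; rewrite pI /rect_le /= pi pj ii jj.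
Qed.

Lemma cell_inj {a b : nat} (x y : 'I_a * 'I_b) :
  x.1 = y.1 :> nat -> x.2 = y.2 :> nat -> x = y.
Proof. by case: x y => [x1 x2] [y1 y2] /= /val_inj -> /val_inj ->. Qed.

(** Every cell strictly below [p] lies weakly below one of its two lower neighbours, so for an ideal
    these neighbours decide minimality. *)
Lemma rect_Tplus {a b : nat} (I : {set 'I_a * 'I_b}) (p : 'I_a * 'I_b) :
  order_ideal (@rect_le a b) I ->
  Tplus_b (@rect_le a b) I p = add_corner (cells I) p.1 p.2.
Proof.
move=> idI; rewrite /Tplus_b /add_corner cells_mem; congr andb.
apply/forallP/andP => [h|[hi hj] x].
  split; rewrite -implyNb; apply/implyP => n0.
    have lt : (p.1.-1 < a)%N by rewrite (leq_ltn_trans (leq_pred _)).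
    move/implyP: (h (Ordinal lt, p.2)); rewrite -cells_mem /=; apply.
    rewrite /lt_of /rect_le /= leq_pred leqnn !andbT.
    by apply/eqP => /(congr1 (fun u => nat_of_ord u.1)) /= pE; move: n0; rewrite -lt0n -pE; lia.
  have lt : (p.2.-1 < b)%N by rewrite (leq_ltn_trans (leq_pred _)).
  move/implyP: (h (p.1, Ordinal lt)); rewrite -cells_mem /=; apply.
  rewrite /lt_of /rect_le /= leq_pred leqnn !andbT.
  by apply/eqP => /(congr1 (fun u => nat_of_ord u.2)) /= pE; move: n0; rewrite -lt0n -pE; lia.
apply/implyP => /andP[xp /andP[x1 x2]]; rewrite -cells_mem.
have : (x.1 < p.1)%N || (x.2 < p.2)%N.
  apply: contraR xp; rewrite negb_or -!leqNgt => /andP[p1 p2].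
  by apply/eqP/cell_inj; apply/eqP; rewrite eqn_leq ?x1 ?x2 ?p1 ?p2.
case/orP => lt.
  have p0 : p.1 != 0%N :> nat by lia.
  by move: hi; rewrite (negbTE p0) /=; apply: cells_lower => //; rewrite -ltnS (ltn_predK lt).
have p0 : p.2 != 0%N :> nat by lia.
by move: hj; rewrite (negbTE p0) /=; apply: cells_lower => //; rewrite -ltnS (ltn_predK lt).
Qed.

Lemma rect_Tminus {a b : nat} (I : {set 'I_a * 'I_b}) (p : 'I_a * 'I_b) :
  order_ideal (@rect_le a b) I ->
  Tminus_b (@rect_le a b) I p = rem_corner (cells I) p.1 p.2.
Proof.
move=> idI; rewrite /Tminus_b /rem_corner cells_mem; congr andb.
apply/forallP/andP => [h|[hi hj] x].
  split; apply/cellsP => -[x [xI x1 x2]];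
  have /implyP/(_ _)/negP := h x; apply => //;
  rewrite /lt_of /rect_le x1 x2 ?leqnn ?leqnSn /= andbT;
  apply/eqP => pE; move: x1 x2; rewrite pE; lia.
apply/implyP => /andP[xp /andP[x1 x2]]; rewrite -cells_mem.
have : (p.1 < x.1)%N || (p.2 < x.2)%N.
  apply: contraR xp; rewrite negb_or -!leqNgt => /andP[p1 p2].
  by apply/eqP/cell_inj; apply/eqP; rewrite eqn_leq ?x1 ?x2 ?p1 ?p2.
case/orP => lt.
  by apply: contra hi; apply: cells_lower.
by apply: contra hj; apply: cells_lower.
Qed.

Lemma rect_rank a b : is_rank (@rect_le a b) (fun p => (p.1 + p.2)%N).
Proof.
split=> [[x y] [u v] /andP[/eqP ne /andP[/= xu yv]]|[u v] /= uv].
  rewrite ltn_neqAle leq_add // andbT; apply/eqP => e; apply: ne.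
  by apply: cell_inj => /=; lia.
have [u0|u0] := posnP u.
  have lt : (v.-1 < b)%N by rewrite (leq_ltn_trans (leq_pred _)).
  exists (u, Ordinal lt) => /=; last by lia.
  rewrite /lt_of /rect_le /= leq_pred leqnn !andbT.
  by apply/eqP => -[/(congr1 val)] /=; lia.
have lt : (u.-1 < a)%N by rewrite (leq_ltn_trans (leq_pred _)).
exists (Ordinal lt, v) => /=; last by lia.
rewrite /lt_of /rect_le /= leq_pred leqnn !andbT.
by apply/eqP => -[/(congr1 val)] /=; lia.
Qed.

Lemma rect_weights {K : fieldType} (q : K) a b :
    1 - q != 0 -> 1 - q ^+ (a + b) != 0 ->
  exists f g : nat -> K,
    [/\ forall i, f i.+1 = q * f i, forall j, g j.+1 = 1 + q * g j,
        f 0%N + g b = 0, f a + g 0%N = 0 &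
        - (f 0%N + g 0%N) * (\sum_(i < a + b) q ^+ i) =
        (\sum_(i < a) q ^+ i) * (\sum_(i < b) q ^+ i)].
Proof.
move=> q1; rewrite exprD => qab.
pose s := (1 - q)^-1.
(* The recurrences have general solutions $Aq^i$ and $Bq^j+s$, with $s=1/(1-q)$ the fixed point. The
   boundary conditions read $A+Bq^b=-s$ and $Aq^a+B=-s$, a linear system of determinant
   $1-q^{a+b}$. *)
exists (fun i => - s * (1 - q ^+ b) / (1 - q ^+ a * q ^+ b) * q ^+ i).
exists (fun j => - s * (1 - q ^+ a) / (1 - q ^+ a * q ^+ b) * q ^+ j + s).
split=> [i|j|||].
- by rewrite exprS; ring.
- by rewrite /s exprS; field; rewrite q1 qab.
- by rewrite /s expr0; field; rewrite q1 qab.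
- by rewrite /s expr0; field; rewrite q1 qab.
(* Multiplication by $(1-q)^2$ turns all the geometric sums into closed forms. *)
- have e x y : (1 - q) * ((1 - q) * (x * y)) = ((1 - q) * x) * ((1 - q) * y) by ring.
  apply: (mulfI q1); apply: (mulfI q1); rewrite !e !geom_sum exprD /s expr0.
  by field; rewrite q1 qab.
Qed.

Lemma rect_antichain a b : (0 < a)%N -> (0 < b)%N -> antichain_qconstant (@rect_le a b).
Proof.
case: a b => // a [] // b _ _.
have [|f [g [fS gS fgb fga rhoE]]] :=
  rect_weights qvar a.+1 b.+1 (qvarB1_neq0 1 isT); first exact: qvarB1_neq0.
apply: (@qequiv_criterion _ (@rect_le a.+1 b.+1) (fun p => (p.1 + p.2)%N)
  (a + b) (fun p => f p.1 + g p.2) (- (f 0%N + g 0%N))) => //.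
- exact: rect_rank.
- by case=> x y /=; rewrite leq_add // -ltnS.
- by exists (ord_max, ord_max).
- rewrite -(pair_bigA _ (fun (i : 'I_a.+1) (j : 'I_b.+1) => qvar ^+ (i + j))) /=.
  have -> : (a + b + 2 = a.+1 + b.+1)%N by lia.
  rewrite rhoE mulr_suml; apply: eq_bigr => i _; rewrite mulr_sumr.
  by apply: eq_bigr => j _; rewrite exprD.
- move=> I idI; rewrite opprK.
  rewrite -(weighted_corners (cells I) f g a b) //; last 3 first.
  + exact: cells_lower.
  + by move=> j; apply/cellsP => -[[x y] [_ /= xa _]]; have := ltn_ord x; rewrite xa ltnn.
  + by move=> i; apply/cellsP => -[[x y] [_ /= _ yb]]; have := ltn_ord y; rewrite yb ltnn.
  rewrite big_mkord; under [RHS]eq_bigr do rewrite big_mkord.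
  rewrite pair_bigA /=; apply: eq_bigr => p _.
  by rewrite rect_Tplus // rect_Tminus // fS gS mulrDr addrCA.
Qed.

(** * Shifted staircases *)

(** If [m] contains exactly the first $d$ diagonal cells, then $(d,d)$ is addable when $d=0$ or
    $(d-1,d)$ is in [m]; otherwise $(d-1,d-1)$ is removable. The two cases exclude each other. *)
Lemma diagonal_corners {K : comRingType} (m : rel nat) n :
    (forall i j i' j', (i' <= i)%N -> (j' <= j)%N -> m i j -> m i' j') ->
    (forall i j, m i j = m j i) -> ~~ m n n.+1 ->
  \sum_(0 <= i < n.+1) ((add_corner m i i)%:R + (rem_corner m i i)%:R) = 1 :> K.
Proof.
move=> m_lower m_sym mn; pose w i : K := - ((i == 0%N) || m i.-1 i)%:R.
rewrite (eq_bigr (fun j => w j.+1 - w j)) => [|i _].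
  by rewrite telescope_sumr // /w /= (negbTE mn) oppr0 sub0r opprK.
rewrite /w /add_corner /rem_corner /= (m_sym i i.-1) (m_sym i.+1 i).
have := m_lower i i i.-1 i (leq_pred i) (leqnn i).
have := m_lower i i.+1 i i (leqnn i) (leqnSn i).
case: (i == 0%N); case: (m i i); case: (m i.-1 i); case: (m i i.+1) => //= h1 h2;
  rewrite ?opprK ?addNr ?addr0 ?oppr0 ?add0r //;
  by [have := h1 isT|have := h2 isT].
Qed.

Definition swap {A B : Type} (p : A * B) : B * A := (p.2, p.1).

(** The orbits of [swap] on the square each meet the staircase in exactly one cell. *)
Lemma sum_stair {V : zmodType} n (H : 'I_n * 'I_n -> V) :
  \sum_p H p = \sum_(x : stair_T n)
    (H (val x) + if (val x).1 == (val x).2 then 0 else H (swap (val x))).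
Proof.
pose G p := H p + if p.1 == p.2 then 0 else H (swap p).
have -> : \sum_(x : stair_T n) G (val x) = \sum_(p : 'I_n * 'I_n | (p.1 <= p.2)%N) G p.
  rewrite (reindex_omap (val : stair_T n -> _) insub) => [|p pp].
    by apply: eq_bigl => x; rewrite valK eqxx andbT (valP x).
  by rewrite insubT.
rewrite (bigID (fun p : 'I_n * 'I_n => (p.1 <= p.2)%N)) /= big_split /=.
congr (_ + _); rewrite (reindex_onto swap swap) => [|[]] //.
rewrite [RHS]big_mkcond [LHS]big_mkcond; apply: eq_bigr => -[i j] _ /=.
rewrite /swap /= eqxx andbT -ltnNge ltn_neqAle -val_eqE /=.
by case: eqP => //= _; case: ifP.
Qed.

Lemma sum_stair_diagonal {V : zmodType} n (D : 'I_n -> V) :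
  \sum_(x : stair_T n) (if (val x).1 == (val x).2 then D (val x).1 else 0)
  = \sum_i D i.
Proof.
pose H (p : 'I_n * 'I_n) := if p.1 == p.2 then D p.1 else 0.
transitivity (\sum_p H p).
  rewrite sum_stair; apply: eq_bigr => -[[i j] ij] _; rewrite /H /= [j == i]eq_sym.
  by case: eqP; rewrite addr0.
rewrite -(pair_bigA _ (fun i j => H (i, j))) /=; apply: eq_bigr => i _.
by rewrite /H /= -big_mkcond /= (big_pred1 i) // => j; rewrite /= eq_sym.
Qed.

Section Unfold.
Context {n : nat} (I : {set stair_T n}).
Hypothesis idI : order_ideal (@stair_le n) I.

(* The symmetric ideal of the square whose part on or above the diagonal is I. *)
Definition unfold : {set 'I_n * 'I_n} :=
  [set p | [exists x in I, (val x == p) || (val x == swap p)]].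

Lemma swap_unfold p : (swap p \in unfold) = (p \in unfold).
Proof.
by rewrite !inE; apply: eq_existsb => x; rewrite /swap /= -surjective_pairing orbC.
Qed.

Lemma val_unfold (x : stair_T n) : (val x \in unfold) = (x \in I).
Proof.
rewrite inE; apply/existsP/idP => [[y /andP[yI /orP[|]]]|xI]; last first.
- by exists x; rewrite xI eqxx.
- case: x y yI => [[i j] /= ij] [[k l] /= kl] yI /eqP[ki lj].
  have e : i = j by apply/val_inj/eqP; rewrite eqn_leq ij /= -ki -lj kl.
  by rewrite (_ : exist _ _ _ = exist _ (k, l) kl) //; apply: val_inj; rewrite /= ki lj e.
- by rewrite val_eqE => /eqP <-.
Qed.

Lemma fold_ex (p : 'I_n * 'I_n) : exists x : stair_T n, p = val x \/ p = swap (val x).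
Proof.
case: p => i j; case/orP: (leq_total i j) => ij.
  by exists (exist _ (i, j) ij); left.
by exists (exist _ (j, i) ij); right.
Qed.

Lemma unfold_ideal : order_ideal (@rect_le n n) unfold.
Proof.
apply/forallP => p; apply/forallP => r; apply/implyP => /andP[pr rI].
have [x xp] := fold_ex p; have [y yr] := fold_ex r.
have xy : stair_le x y.
  case: x y xp yr => [[i j] ij] [[k l] kl] xp yr.
  by case: xp yr pr => -> [] ->; rewrite /rect_le /stair_le /=; move: ij kl => /=; lia.
have yI : y \in I by move: rI; case: yr => ->; rewrite ?swap_unfold val_unfold.
have : x \in I by have /implyP := forallP (forallP idI x) y; apply; rewrite xy.
by case: xp => ->; rewrite ?swap_unfold val_unfold.
Qed.

(** If [swap (val y)] is strictly below [val x], then [y] is already strictly below [x] in the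
    staircase, so the mirrored cells impose no new condition. *)
Lemma stair_Tplus x :
  Tplus_b (@stair_le n) I x = Tplus_b (@rect_le n n) unfold (val x).
Proof.
rewrite /Tplus_b val_unfold; congr andb.
apply/forallP/forallP => h p.
  have [y [->|->]] := fold_ex p; rewrite ?swap_unfold val_unfold; apply/implyP => lt.
    by move/implyP: (h y); apply.
  move/implyP: (h y); apply; move: lt; rewrite /lt_of /stair_le /rect_le /swap.
  case: x y {h} => [[i j] ij] [[k l] kl] /=; rewrite -val_eqE /= !xpair_eqE -!val_eqE /=.
  move: ij kl => /=; lia.
by have := h (val p); rewrite val_unfold.
Qed.

Lemma stair_Tminus x :
  Tminus_b (@stair_le n) I x = Tminus_b (@rect_le n n) unfold (val x).
Proof.
rewrite /Tminus_b val_unfold; congr andb.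
apply/forallP/forallP => h p.
  have [y [->|->]] := fold_ex p; rewrite ?swap_unfold val_unfold; apply/implyP => lt.
    by move/implyP: (h y); apply.
  move/implyP: (h y); apply; move: lt; rewrite /lt_of /stair_le /rect_le /swap.
  case: x y {h} => [[i j] ij] [[k l] kl] /=; rewrite -val_eqE /= !xpair_eqE -!val_eqE /=.
  move: ij kl => /=; lia.
by have := h (val p); rewrite val_unfold.
Qed.

Lemma cells_unfold_sym i j : cells unfold i j = cells unfold j i.
Proof.
by apply/cellsP/cellsP => -[p [pI pi pj]]; exists (swap p); rewrite swap_unfold.
Qed.

End Unfold.

Lemma stair_rank n : is_rank (@stair_le n) (fun x => ((val x).1 + (val x).2)%N).
Proof.
split=> [[[i j] ij] [[k l] kl]|[[i j] ij]].
  rewrite /lt_of /stair_le -val_eqE xpair_eqE -!val_eqE /=.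
  move: ij kl => /=; lia.
move: ij => /= ij ij0.
have lti : (i.-1 < n)%N by rewrite (leq_ltn_trans (leq_pred _)).
have ltj : (j.-1 < n)%N by rewrite (leq_ltn_trans (leq_pred _)).
have [i0|i0] := posnP i.
  have ij' : ((i, Ordinal ltj).1 <= (i, Ordinal ltj).2)%N by rewrite /= i0.
  exists (exist _ (i, Ordinal ltj) ij') => /=; last by lia.
  by rewrite /lt_of /stair_le -val_eqE xpair_eqE -!val_eqE /=; lia.
have ij' : ((Ordinal lti, j).1 <= (Ordinal lti, j).2)%N by rewrite /=; lia.
exists (exist _ (Ordinal lti, j) ij') => /=; last by lia.
by rewrite /lt_of /stair_le -val_eqE xpair_eqE -!val_eqE /=; lia.
Qed.

(** [S] stands for the rank generating function of the staircase: twice it is the sum over the whole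
    square plus the diagonal. The equation for [k] makes the diagonal correction the same for adding
    and for removing a cell. *)
Lemma stair_weights {K : fieldType} (q : K) n (S : K) :
    2 != 0 :> K -> 1 - q != 0 -> 1 + q != 0 -> 1 + q ^+ n != 0 ->
    S *+ 2 = (\sum_(i < n) q ^+ i) ^+ 2 + \sum_(i < n) q ^+ (i + i) ->
  exists (f : nat -> K) (k : K),
    [/\ forall i, f i.+1 = 2^-1 + q * f i, 1 - q * k = 2^-1 + k,
        f 0%N + f n = 0 & (k - f 0%N) * (\sum_(i < n + n) q ^+ i) = S].
Proof.
move=> n2 q1 q1' qn SE.
(* The fixed point of the recurrence is $1/(2(1-q))$, and the coefficient of $q^i$ is forced by
   [f 0 + f n = 0]. *)
exists (fun i => - (1 - q)^-1 / (1 + q ^+ n) * q ^+ i + (1 - q)^-1 / 2).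
exists (2 * (1 + q))^-1; split=> [i|||].
- by rewrite exprS; field; rewrite n2 q1 qn.
- by field; rewrite n2 q1'.
- by rewrite expr0; field; rewrite n2 q1 qn.
have gq2 : (1 - q) * (1 + q) * (\sum_(i < n) q ^+ (i + i)) = 1 - q ^+ n * q ^+ n.
  rewrite -exprD addnn -mul2n exprM -geom_sum; congr (_ * _); first by ring.
  by apply: eq_bigr => i _; rewrite -exprM mul2n addnn.
rewrite -mulr_natr in SE; apply: (mulIf n2); rewrite SE.
apply: (mulfI q1); apply: (mulfI q1); apply: (mulfI q1').
set S2 := \sum_(i < n) q ^+ (i + i) in gq2 *.
have -> : (1 + q) * ((1 - q) * ((1 - q) * ((\sum_(i < n) q ^+ i) ^+ 2 + S2)))
  = (1 + q) * ((1 - q) * (\sum_(i < n) q ^+ i)) ^+ 2 + (1 - q) * ((1 - q) * (1 + q) * S2) by ring.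
rewrite gq2 geom_sum.
have e x y : (1 + q) * ((1 - q) * ((1 - q) * (x * y * 2)))
  = (1 + q) * (1 - q) * x * 2 * ((1 - q) * y) by ring.
rewrite e geom_sum exprD expr0; field.
by rewrite n2 q1 q1' qn.
Qed.

Lemma Rq2_neq0 : 2 != 0 :> Rq.
Proof.
have -> : 2 = tofrac 2 :> Rq by rewrite rmorph_nat.
by apply: qvar_poly_neq0; rewrite hornerMn hornerC pnatr_eq0.
Qed.

Lemma stair_antichain n : (0 < n)%N -> antichain_qconstant (@stair_le n).
Proof.
case: n => // n _.
have := stair_weights qvar n.+1 (\sum_(x : stair_T n.+1) qvar ^+ ((val x).1 + (val x).2)%N)
  Rq2_neq0 (qvarB1_neq0 1 isT) (qvarD1_neq0 1 isT) (qvarD1_neq0 n.+1 isT).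
case.
  rewrite -(sum_stair_diagonal _ (fun i => qvar ^+ (i + i))).
  rewrite expr2 mulr_suml.
  under [X in _ = X + _]eq_bigr do rewrite mulr_sumr.
  under [X in _ = X + _]eq_bigr => i _ do under eq_bigr => j _ do rewrite -exprD.
  rewrite (pair_bigA _ (fun i j : 'I_n.+1 => qvar ^+ (i + j))) /= sum_stair.
  rewrite -big_split /= -sumrMnl; apply: eq_bigr => x _; rewrite mulr2n -addrA.
  congr (_ + _); rewrite /swap /= addnC; case: eqP => [->|_]; by rewrite ?add0r ?addr0.
move=> f [k [fS kE f0n rhoE]].
(* Folding the row weights of the square gives [f i + f j] off the diagonal but a single [f i] on
   it. With the shift [- k], a diagonal cell is added with weight [f i - k] and removed with weight
   [f i.+1 + k], so each diagonal corner contributes an extra [- k], and there is exactly one. *)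
pose c (x : stair_T n.+1) := f (val x).1 + if (val x).1 == (val x).2 then - k else f (val x).2.
apply: (@qequiv_criterion _ (@stair_le n.+1) (fun x => ((val x).1 + (val x).2)%N)
  (n + n) c (k - f 0%N)) => //.
- exact: stair_rank.
- by case=> [[i j] ij] /=; rewrite leq_add // -ltnS.
- by exists (exist _ (ord_max, ord_max) (leqnn _)).
- by rewrite -rhoE (_ : n + n + 2 = n.+1 + n.+1)%N //; lia.
move=> I idI; pose m := cells (unfold I).
have m_lower := cells_lower _ (unfold_ideal _ idI).
have m_sym := cells_unfold_sym I.
have m0 j : ~~ m n.+1 j.
  by apply/cellsP => -[[x y] [_ /= xa _]]; have := ltn_ord x; rewrite xa ltnn.
have m0' i : ~~ m i n.+1 by rewrite /m m_sym.
have addS i j : add_corner m i j = add_corner m j i.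
  by rewrite /add_corner /m m_sym (m_sym i.-1) (m_sym i j.-1) [X in _ && X]andbC.
have remS i j : rem_corner m i j = rem_corner m j i.
  by rewrite /rem_corner /m m_sym (m_sym i.+1) (m_sym i j.+1) [X in _ && X]andbC.
have rows := weighted_row_corners m m_lower f n n m0 m0'.
have diag := diagonal_corners (K := Rq) m n m_lower m_sym (m0' n).
rewrite big_mkord -(sum_stair_diagonal _ (fun i : 'I_n.+1 =>
  (add_corner m i i)%:R + (rem_corner m i i)%:R)) in diag.
move: rows; rewrite big_mkord; under eq_bigr do rewrite big_mkord.
rewrite pair_bigA /= sum_stair => rows.
(* By symmetry of [m] and [f n.+1 = - f 0], the two boundary terms of the row sum add up to
   [f 0]. *)
have -> : - (k - f 0%N) =
  f 0%N * (1 - (m 0%N n)%:R) - f n.+1 * (m n 0%N)%:R - k * 1.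
  rewrite /m (m_sym n); have -> : f n.+1 = - f 0%N by apply/eqP; rewrite -addr_eq0 addrC f0n.
  ring.
rewrite -rows -[in k * 1]diag mulr_sumr -sumrB; apply: eq_bigr => x _.
rewrite stair_Tplus // stair_Tminus // rect_Tplus ?rect_Tminus; try exact: unfold_ideal.
rewrite /swap /= -/m (addS (val x).2) (remS (val x).2) /c !fS.
case: eqP => [->|_]; last first.
  (* The 1 in $1+qc$ is shared equally between the two coordinates, each half completing one step of
     the recurrence of [f]. *)
  have half : 1 = 2^-1 + 2^-1 :> Rq by rewrite -mulr2n -[LHS](mulfV Rq2_neq0) mulr_natl.
  rewrite mulr0 subr0 [X in (X + qvar * _) * _]half; ring.
have -> : 1 + qvar * (f (val x).2 - k) = (1 - qvar * k) + qvar * f (val x).2 by ring.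
rewrite kE; ring.
Qed.

(** * Double-tailed diamonds *)

Section DoubleTailedDiamond.
Variable t : nat.

(* With n = t.+2, the indices 0..t are the x_i, t.+1 and t.+2 the y_j, and
   t.+3..(t + t).+3 the z_i in increasing order. *)
Definition dtd_add (m : pred nat) k :=
  ~~ m k && if k == t.+2 then m t
            else ((k == 0%N) || m k.-1) && ((k == t.+3) ==> m t.+1).
Definition dtd_rem (m : pred nat) k :=
  m k && ~~ (if k == t.+1 then m t.+3 else m k.+1 || (k == t) && m t.+2).

(** The hypotheses on [c] are the identity read off ideal by ideal: the empty ideal gives [c 0], an
    ideal ending at a chain element gives the recurrence, and the ideals ending at [t], at one $y_j$
    and at both give the equations at the fork. The index [(t + t).+4] is one past the top, and its
    value 0 covers the full ideal. *)
Lemma dtd_weighted {K : comRingType} (m : pred nat) (q : K) (c : nat -> K) rho :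
    (forall a b, (a < b)%N -> ~~ ((a == t.+1) && (b == t.+2)) -> m b -> m a) ->
    ~~ m (t + t).+4 ->
    c 0%N = - rho -> c (t + t).+4 = 0 -> c t.+2 = c t.+1 ->
    (forall k, (k != t) && (k != t.+1) && (k != t.+2) -> 1 + q * c k = c k.+1 + rho) ->
    1 + q * c t = c t.+1 *+ 2 + rho -> 1 + q * c t.+1 = c t.+1 + rho ->
    c t.+3 = c t.+1 *+ 2 + rho ->
  \sum_(0 <= k < (t + t).+4)
     (c k * (dtd_add m k)%:R - (1 + q * c k) * (dtd_rem m k)%:R) = - rho.
Proof.
move=> m_lower mtop c0 ctop cyy cS ct cy cz.
have m_pred k : (k != t.+1) -> m k.+1 ==> m k.
  by move=> kt; apply/implyP; apply: m_lower => //; rewrite eqSS (negbTE kt).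
(* Partial sums of the weights over the lower and the upper chain. *)
pose G k := - rho * (1 - ((k == 0%N) || m k.-1)%:R)
  - (c k + rho) * (((k == 0%N) || m k.-1)%:R - (m k)%:R).
pose H k := rho * (m k.-1)%:R - (c k + rho) * ((m k.-1)%:R - (m k)%:R).
rewrite (big_cat_nat (n := t)) //=; last by lia.
rewrite [X in X + _](eq_big_nat _ _ (F2 := fun k => G k.+1 - G k)); last first.
  move=> k /= kt; rewrite cS; last by lia.
  rewrite /G /dtd_add /dtd_rem !ifF; try by lia.
  rewrite (_ : (k == t.+3) = false) /=; last by lia.
  rewrite (_ : (k == t) = false) /=; last by lia.
  have := m_pred k; have := m_pred k.-1; case: k kt => [|k] /= kt.
    move=> _ /(_ isT); case: (m 0%N); case: (m 1%N) => //= _; ring.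
  move=> /(_ ltac:(lia)) + /(_ ltac:(lia)).
  case: (m k); case: (m k.+1); case: (m k.+2) => //= _ _; ring.
rewrite telescope_sumr // (big_cat_nat (n := t.+4)) //=; try by lia.
rewrite [X in _ + (_ + X)](eq_big_nat _ _ (F2 := fun k => H k.+1 - H k)); last first.
  move=> k /= kt; rewrite cS; last by lia.
  rewrite /H /dtd_add /dtd_rem !ifF; try by lia.
  rewrite (_ : (k == t.+3) = false) /=; last by lia.
  rewrite (_ : (k == t) = false) /=; last by lia.
  have := m_pred k; have := m_pred k.-1; case: k kt => [|k] /= kt; first by lia.
  move=> /(_ ltac:(lia)) + /(_ ltac:(lia)).
  case: (m k); case: (m k.+1); case: (m k.+2) => //= _ _; ring.
rewrite telescope_sumr //; last by lia.
rewrite (_ : \sum_(t <= k < t.+4) _ = \sum_(0 <= k < 4)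
  (c (k + t)%N * (dtd_add m (k + t))%:R
   - (1 + q * c (k + t)%N) * (dtd_rem m (k + t))%:R)); last first.
  by rewrite -{1}[t]add0n -[t.+4]/(4 + t)%N big_addn addnK.
rewrite unlock /= !addSn !add0n addr0 ct cyy cy cS; last by lia.
rewrite /G /H /= c0 ctop (negbTE mtop) /= cz.
have [e1 e2 e3] : [/\ (t == t.+1) = false, (t == t.+2) = false & (t == t.+3) = false].
  by split; lia.
have [e1' e2' e3'] : [/\ (t.+1 == t) = false, (t.+2 == t) = false & (t.+3 == t) = false].
  by split; lia.
rewrite /dtd_add /dtd_rem !eqSS !eqxx e1 e2 e3 e1' e2' e3' /= andbT !orbF.
(* The four indices around the fork are settled by cases on membership, subject to these
   consequences of lower closure. *)
have h1 := m_pred t ltac:(lia).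
have h2 := m_lower t t.+2 ltac:(lia) ltac:(lia).
have h3 := m_lower t.+1 t.+3 ltac:(lia) ltac:(lia).
have h4 := m_pred t.+2 ltac:(lia).
have h5 := m_pred t.+3 ltac:(lia).
have h6 : m t ==> (t == 0%N) || m t.-1.
  by apply/implyP => mt; case: (posnP t) => [->//|t0]; rewrite (m_lower t.-1 t) ?orbT //; lia.
move: h1 h2 h3 h4 h5 h6.
case: (m t.+4); case: (m t.+3); case: (m t.+2); case: (m t.+1); case: (m t);
  case: (_ || m t.-1) => //= h1 h2 h3 h4 h5 h6;
  try (by have := h2 isT); try (by have := h3 isT); ring.
Qed.

(** The constant solution of $1+qc=c+\rho$ is $-q^{t+1}/(1+q^{t+2})$, the value at $y_1,y_2$. Along
    each chain the deviation from it is multiplied by $q$ at every step; its scale is fixed by the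
    values at index 0 and at index [(t + t).+4]. *)
Definition dtd_coef {K : fieldType} (q : K) k : K :=
  ((if (k <= t)%N then - q ^+ k else if (k <= t.+2)%N then 0 else q ^+ (k - t.+3))
   - q ^+ t.+1) / (1 + q ^+ t.+2).

Lemma dtd_weights {K : fieldType} (q : K) :
    1 + q ^+ t.+2 != 0 ->
  let c := dtd_coef q in let rho := (1 + q ^+ t.+1) / (1 + q ^+ t.+2) in
  [/\ c 0%N = - rho, c (t + t).+4 = 0 & c t.+2 = c t.+1] /\
  [/\ forall k, (k != t) && (k != t.+1) && (k != t.+2) -> 1 + q * c k = c k.+1 + rho,
    1 + q * c t = c t.+1 *+ 2 + rho, 1 + q * c t.+1 = c t.+1 + rho &
    c t.+3 = c t.+1 *+ 2 + rho].
Proof.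
rewrite [q ^+ t.+2]exprS => qn c rho; rewrite /c /rho /dtd_coef [q ^+ t.+2]exprS.
rewrite !leqnn leqnSn ltnn (ltnNge t.+1) leqnSn (ltnNge t.+2) (leqW (leqnSn t)) /= ltnn subnn.
rewrite (_ : ((t + t).+4 <= t)%N = false); last by lia.
rewrite (_ : ((t + t).+4 <= t.+2)%N = false); last by lia.
rewrite (_ : ((t + t).+4 - t.+3)%N = t.+1); last by lia.
do 2?split; rewrite ?expr0 ?subrr ?mul0r //; try (by rewrite ?exprS; field; rewrite -exprS).
move=> k kt; case: (leqP k t) => kt1.
  rewrite ifT; last by lia.
  by rewrite [q ^+ k.+1]exprS; field.
rewrite !ifF; try by lia.
rewrite (_ : (k.+1 - t.+3)%N = (k - t.+3).+1); last by lia.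
by rewrite [q ^+ (_ - _).+1]exprS; field.
Qed.

(** Both $y_1$ and $y_2$ have rank [t.+1], so the rank lags one behind the index from [t.+2] on. *)
Lemma dtd_rank :
  is_rank (@dtd_le t.+2) (fun k => if (k < t.+2)%N then k : nat else k.-1).
Proof.
split=> [x y|y y0].
  by rewrite /lt_of /dtd_le -val_eqE /=; case: ifP; case: ifP; lia.
(* Below $y_2$ the witness skips the incomparable $y_1$ and is [t]. *)
have lt : ((if y == t.+2 :> nat then t else y.-1) < 2 * t.+2)%N.
  by have := ltn_ord y; case: ifP; lia.
by exists (Ordinal lt); move: y0; rewrite /lt_of /dtd_le -?val_eqE /=; do ?case: ifP; lia.
Qed.

Lemma dtd_antichain : antichain_qconstant (@dtd_le t.+2).
Proof.
have [[c0 ctop cyy] [cS ct cy cz]] := dtd_weights qvar (qvarD1_neq0 t.+2 isT).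
set c := dtd_coef qvar in c0 ctop cyy cS ct cy cz.
apply: (@qequiv_criterion _ (@dtd_le t.+2)
  (fun k => if (k < t.+2)%N then k : nat else k.-1) (t + t).+2 (fun k => c k)
  ((1 + qvar ^+ t.+1) / (1 + qvar ^+ t.+2))).
- exact: dtd_rank.
- by move=> p; have := ltn_ord p; case: ifP; lia.
- have lt : ((t + t).+3 < 2 * t.+2)%N by lia.
  by exists (Ordinal lt) => /=; case: ifP; lia.
(* The rank generating function is $(1+q^{t+1})[t+2]_q$, while $[2t+4]_q=(1+q^{t+2})[t+2]_q$; their
   ratio is [rho]. *)
- rewrite -(big_mkord xpredT (fun k => qvar ^+ (if (k < t.+2)%N then k else k.-1))).
  rewrite (big_cat_nat (n := t.+2)) //=; last by lia.
  rewrite (_ : 2 * t.+2 = t.+2 + t.+2)%N; last by lia.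
  have shift (F : nat -> Rq) :
      \sum_(t.+2 <= k < t.+2 + t.+2) F k = \sum_(0 <= k < t.+2) F (k + t.+2)%N.
    by rewrite -{1}[t.+2]add0n big_addn addnK.
  rewrite shift !big_mkord.
  under eq_bigr => i _ do rewrite ltn_ord.
  under [X in _ = _ + X]eq_bigr => i _.
    rewrite ifF; last by lia.
    rewrite addnS /= addnC exprD; over.
  rewrite -mulr_sumr -[X in _ = X + _]mul1r -mulrDl.
  rewrite (_ : (t + t).+2 + 2 = t.+2 + t.+2)%N; last by lia.
  rewrite /qint big_split_ord /=.
  under [X in _ * (_ + X)]eq_bigr => i _ do rewrite exprD.
  rewrite -mulr_sumr -[X in _ * (X + _)]mul1r -mulrDl mulrA divfK //.
  exact: qvarD1_neq0.
move=> I idI.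
pose m k := [exists p : 'I_(2 * t.+2), (p \in I) && (p == k :> nat)].
have mE (p : 'I_(2 * t.+2)) : m p = (p \in I).
  apply/existsP/idP => [[r /andP[rI /eqP/val_inj <-]]|pI] //.
  by exists p; rewrite pI eqxx.
have m_bound : forall k, m k -> (k < 2 * t.+2)%N.
  by move=> k /existsP[p /andP[_ /eqP <-]].
clearbody m.
have mtop k : (2 * t.+2 <= k)%N -> m k = false.
  by move=> kt; apply/negP => mk; have := m_bound _ mk; lia.
have m_lower a b : (a < b)%N -> ~~ ((a == t.+1) && (b == t.+2)) -> m b -> m a.
  move=> ab yy mb; have lb := m_bound _ mb; have la := ltn_trans ab lb.
  move: mb; rewrite -[b]/(nat_of_ord (Ordinal lb)) -[a]/(nat_of_ord (Ordinal la)) !mE => bI.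
  have /implyP := forallP (forallP idI (Ordinal la)) (Ordinal lb); apply.
  by rewrite bI /dtd_le /= ab yy orbT.
have addE (p : 'I_(2 * t.+2)) : Tplus_b (@dtd_le t.+2) I p = dtd_add m p.
  rewrite /Tplus_b /dtd_add mE; congr andb.
  apply/forallP/idP => [h|h x].
    have below a : (a < p)%N -> ~~ ((a == t.+1) && (p == t.+2 :> nat)) -> m a.
      move=> ap yy; have la := ltn_trans ap (ltn_ord p).
      have /implyP := h (Ordinal la); rewrite -mE; apply.
      by rewrite /lt_of /dtd_le -val_eqE /= ap yy orbT andbT neq_ltn ap.
    case: eqP => [p2|p2]; first by apply: below; lia.
    apply/andP; split; last by apply/implyP => p3; apply: below; lia.
    by rewrite -implyNb; apply/implyP => p0; apply: below; lia.
  rewrite -mE; apply/implyP; rewrite /lt_of /dtd_le -val_eqE /= => xp.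
  have {xp}[xp yy] : (x < p)%N /\ ~~ ((x == t.+1 :> nat) && (p == t.+2 :> nat)) by lia.
  move: h; case: eqP => [p2|p2].
    have [->|xt] := eqVneq (x : nat) t; first by [].
    by apply: m_lower; lia.
  rewrite (_ : (p == 0%N :> nat) = false) /=; last by lia.
  have [->|xt] := eqVneq (x : nat) p.-1; first by case/andP.
  case/andP => h1 /implyP h2.
  have [xt1|xt1] := boolP ((x == t.+1 :> nat) && (p.-1 == t.+2)).
    by rewrite (eqP (proj1 (andP xt1))); apply: h2; lia.
  by apply: m_lower h1; [lia|].
have remE (p : 'I_(2 * t.+2)) : Tminus_b (@dtd_le t.+2) I p = dtd_rem m p.
  rewrite /Tminus_b /dtd_rem mE; congr andb.
  apply/forallP/idP => [h|h x].
    have above a : (p < a)%N -> ~~ ((p == t.+1 :> nat) && (a == t.+2)) -> ~~ m a.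
      move=> pa yy; apply/negP => ma; have la := m_bound _ ma.
      move/implyP: (h (Ordinal la)); rewrite -mE /= ma => hF.
      suff: false by []; apply: hF.
      by rewrite /lt_of /dtd_le -val_eqE /= pa yy orbT andbT neq_ltn pa.
    case: eqP => [p2|p2]; first by apply: above; lia.
    rewrite negb_or above; try lia.
    by rewrite negb_and -implybE; apply/implyP => p3; apply: above; lia.
  rewrite -mE; apply/implyP; rewrite /lt_of /dtd_le -val_eqE /= => xp.
  have {xp}[xp yy] : (p < x)%N /\ ~~ ((p == t.+1 :> nat) && (x == t.+2 :> nat)) by lia.
  move: h; apply: contra => mx; case: eqP => [p2|p2].
    have [<-|xt] := eqVneq (x : nat) t.+3; first by [].
    by apply: m_lower mx; lia.
  have [xt|xt] := eqVneq (x : nat) p.+1; first by rewrite -xt mx.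
  have [xt1|xt1] := boolP ((p == t :> nat) && (x == t.+2 :> nat)).
    by case/andP: xt1 => -> /eqP x2; rewrite x2 in mx; rewrite mx orbT.
  by apply/orP; left; apply: m_lower mx; lia.
rewrite -(dtd_weighted m qvar c _ m_lower _ c0 ctop cyy cS ct cy cz); last first.
  by rewrite mtop //; lia.
rewrite (_ : (t + t).+4 = 2 * t.+2)%N; last by lia.
by rewrite big_mkord; apply: eq_bigr => p _; rewrite addE remE.
Qed.

End DoubleTailedDiamond.

(** * Exceptional posets *)

Section IntegerLists.
Context {K : comRingType} (q : K).

Definition list_eval (s : seq int) : K := foldr (fun a v => a%:~R + q * v) 0 s.

Fixpoint list_add (s t : seq int) : seq int :=
  match s, t with
  | a :: s', b :: t' => a + b :: list_add s' t'
  | [::], _ => t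
  | _, [::] => s
  end.

Definition list_mul (s t : seq int) : seq int :=
  foldr (fun a v => list_add [seq a * b | b <- t] (0 :: v)) [::] s.

Lemma list_eval_add s t : list_eval (list_add s t) = list_eval s + list_eval t.
Proof.
elim: s t => [|a s IHs] [|b t] /=; rewrite ?add0r ?addr0 //.
by rewrite IHs intrD; ring.
Qed.

Lemma list_eval_scale a s : list_eval [seq a * b | b <- s] = a%:~R * list_eval s.
Proof. by elim: s => /= [|b s ->]; rewrite ?mulr0 // intrM; ring. Qed.

Lemma list_eval_mul s t : list_eval (list_mul s t) = list_eval s * list_eval t.
Proof.
elim: s => [|a s IHs] /=; first by rewrite mul0r.
by rewrite list_eval_add list_eval_scale /= IHs; ring.
Qed.

Lemma list_eval_eq0 s : all (pred1 0) s -> list_eval s = 0.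
Proof. by elim: s => //= a s IHs /andP[/eqP -> /IHs ->]; rewrite mulr0 addr0. Qed.

Lemma list_eval_monomial k : list_eval (rcons (nseq k 0) 1) = q ^+ k.
Proof.
elim: k => [|k IHk] /=; first by rewrite mulr0 addr0.
by rewrite IHk add0r exprS.
Qed.

Lemma list_eval_nseq k : list_eval (nseq k 1) = \sum_(i < k) q ^+ i.
Proof.
elim: k => [|k IHk] /=; first by rewrite big_ord0.
by rewrite IHk big_ord_recl expr0 mulr_sumr; congr (_ + _); apply: eq_bigr => i _; rewrite exprS.
Qed.

Lemma list_eval_foldr {A : Type} (F : A -> seq int) (r : seq A) :
  list_eval (foldr (fun x v => list_add (F x) v) [::] r) = \sum_(x <- r) list_eval (F x).
Proof.
elim: r => [|x r IHr] /=; first by rewrite big_nil.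
by rewrite list_eval_add IHr big_cons.
Qed.

End IntegerLists.

(** The value at [qvar] is the image of a genuine polynomial whose constant term is 1. *)
Lemma list_eval_qvar_neq0 s : head 0 s == 1 -> list_eval qvar s != 0.
Proof.
case: s => [|? s] // /eqP /= ->.
pose P := list_eval ('X : {poly Rdefinitions.R}).
have PE u : list_eval qvar u = tofrac (P u).
  elim: u => [|a u IHu]; first by rewrite rmorph0.
  by rewrite -[P _]/(a%:~R + 'X * P u) rmorphD rmorphM rmorph_int /= IHu.
rewrite -[1%:~R + _]/(list_eval qvar (1 :: s)) PE; apply: qvar_poly_neq0.
by rewrite /P /= !hornerE oner_neq0.
Qed.

Lemma clear_denominator {K : fieldType} (q c A B d : K) : d != 0 ->
  d * (c / d * A - (1 + q * (c / d)) * B) = c * A - (d + q * c) * B.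
Proof. by move=> d0; field. Qed.

(** * Verification by computation over all ideals of a poset on indices *)

Section RootPosets.
Variables (n : nat) (R : rel nat).
Let leR : rel 'I_n := fun i j => R i j.

(* Characteristic sequences of the ideals of {0, .., k-1}, when 0, 1, ... is a
   linear extension. *)
Fixpoint ideal_masks k : seq bitseq :=
  if k is k'.+1 then
    flatten [seq rcons s false ::
               (if all (fun x => R x k' ==> nth false s x) (iota 0 k')
                then [:: rcons s true] else [::]) | s <- ideal_masks k']
  else [:: [::]].

(** The enumeration misses no ideal: the prefix of length [k] comes from the induction, and lower
    closure makes the filter accept a last bit [true]. *)
Lemma mem_ideal_masks (m : pred nat) k :
    (forall x y, (x < k)%N -> (y < k)%N -> R x y -> m y -> m x) ->
  mkseq m k \in ideal_masks k.
Proof.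
elim: k => [|k IHk] m_lower //=.
have -> : mkseq m k.+1 = rcons (mkseq m k) (m k).
  by rewrite /mkseq -addn1 iotaD map_cat cats1.
apply/flattenP; eexists.
  apply/map_f/IHk => x y xk yk; apply: m_lower; exact: leqW.
case mk : (m k); rewrite inE ?eqxx //; apply/orP; right.
rewrite ifT ?inE //; apply/allP => x; rewrite mem_iota => /= xk.
by apply/implyP => Rxk; rewrite nth_mkseq //; apply: (m_lower x k) => //; apply: leqW.
Qed.

(** [mask_plus] and [mask_minus] mirror [Tplus_b] and [Tminus_b] on bit sequences, quantifying over
    [iota] so that they evaluate. *)
Definition mask_plus s p :=
  ~~ nth false s p && all (fun x => (x != p) && R x p ==> nth false s x) (iota 0 n).
Definition mask_minus s p :=
  nth false s p && all (fun x => (p != x) && R p x ==> ~~ nth false s x) (iota 0 n).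

Definition check_rank (r : nat -> nat) :=
  all (fun x => all (fun y => (x != y) && R x y ==> (r x < r y)%N) (iota 0 n)) (iota 0 n)
  && all (fun y => (0 < r y)%N ==>
       has (fun x => [&& x != y, R x y & (r x).+1 == r y]) (iota 0 n)) (iota 0 n).

(** The weighted identity multiplied by the common denominator: $1+qc_p$ becomes [den] plus $q$
    times the numerator, and prepending 0 is multiplication by $q$. Vanishing is tested entrywise
    because sums may carry trailing zeros. *)
Definition check_toggle (c : nat -> seq int) (den const : seq int) :=
  all (fun s => all (pred1 0) (list_add const
         (foldr (fun p v => list_add
            (list_add (if mask_plus s p then c p else [::])
               (if mask_minus s p then [seq -1 * a | a <- list_add den (0 :: c p)] else [::])) v)
            [::] (iota 0 n))))
    (ideal_masks n).

Definition check_const (r : nat -> nat) N (den const : seq int) :=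
  all (pred1 0) (list_add (list_mul const (nseq (N + 2) 1))
    [seq -1 * a | a <- list_mul den
       (foldr (fun p v => list_add (rcons (nseq (r p) 0) 1) v) [::] (iota 0 n))]).

Lemma forall_ord (P : pred nat) : [forall x : 'I_n, P x] = all P (iota 0 n).
Proof.
apply/forallP/allP => [h x|h x]; last by apply: h; rewrite mem_iota ltn_ord.
by rewrite mem_iota => /= xn; apply: (h (Ordinal xn)).
Qed.

(** Turns boolean checks on integer lists into the statement over $\mathbb{R}(q)$; the leading 1 of
    [den] keeps the common denominator nonzero. *)
Lemma list_toggle (r : nat -> nat) N (c : nat -> seq int) (den const : seq int) :
    check_rank r -> all (fun p => (r p <= N)%N) (iota 0 n) ->
    has (fun p => r p == N) (iota 0 n) ->
    head 0 den == 1 -> check_toggle c den const -> check_const r N den const ->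
  antichain_qconstant leR.
Proof.
move=> /andP[/allP r_lt /allP r_cov] /allP rN /hasP[p0 + /eqP rp0] den1 /allP ok okc.
rewrite mem_iota /= => p0n.
have sum_iota (F : nat -> Rq) : \sum_(p <- iota 0 n) F p = \sum_(p < n) F p.
  by rewrite -(big_mkord xpredT) /index_iota subn0.
have ord_iota (x : 'I_n) : (x : nat) \in iota 0 n by rewrite mem_iota ltn_ord.
have D0 := list_eval_qvar_neq0 den den1; set D := list_eval qvar _ in D0.
apply: (@qequiv_criterion _ leR r N
  (fun p => list_eval qvar (c p) / D) (list_eval qvar const / D)) => //.
- split=> [x y|y].
    have /allP/(_ _ (ord_iota y))/implyP := r_lt x (ord_iota x).
    by rewrite /lt_of -val_eqE.
  move/implyP: (r_cov y (ord_iota y)) => h /h /hasP[x].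
  rewrite mem_iota /= => xn /and3P[xy Rxy /eqP rxy].
  by exists (Ordinal xn); rewrite // /lt_of -val_eqE /= xy.
- by move=> p; apply: rN.
- by exists (Ordinal p0n).
- apply: (mulIf D0); rewrite mulrAC divfK //.
  have /eqP := list_eval_eq0 qvar _ okc.
  rewrite list_eval_add list_eval_scale mulN1r subr_eq0 !list_eval_mul => /eqP.
  rewrite list_eval_nseq list_eval_foldr sum_iota -/D => ->.
  by rewrite mulrC; congr (_ * _); apply: eq_bigr => p _; rewrite list_eval_monomial.
move=> I idI.
pose m k := [exists p : 'I_n, (p \in I) && (p == k :> nat)].
have mE (p : 'I_n) : m p = (p \in I).
  apply/existsP/idP => [[u /andP[uI /eqP/val_inj <-]]|pI] //.
  by exists p; rewrite pI eqxx.
clearbody m.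
pose s := mkseq m n.
have sE (p : 'I_n) : nth false s p = (p \in I) by rewrite nth_mkseq.
have plusE p : Tplus_b leR I p = mask_plus s p.
  rewrite /Tplus_b /mask_plus sE -forall_ord; congr andb.
  by apply: eq_forallb => x; rewrite /lt_of sE -val_eqE.
have minusE p : Tminus_b leR I p = mask_minus s p.
  rewrite /Tminus_b /mask_minus sE -forall_ord; congr andb.
  by apply: eq_forallb => x; rewrite /lt_of sE -val_eqE.
have /ok : s \in ideal_masks n.
  apply: mem_ideal_masks => x y xn yn Rxy.
  rewrite -[x]/(nat_of_ord (Ordinal xn)) -[y]/(nat_of_ord (Ordinal yn)) !mE => yI.
  by have /implyP := forallP (forallP idI (Ordinal xn)) (Ordinal yn); apply; rewrite yI andbT.
move/(list_eval_eq0 qvar); rewrite list_eval_add list_eval_foldr.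
rewrite sum_iota => /eqP; rewrite addrC addr_eq0 => /eqP sumE.
apply: (mulfI D0); rewrite mulrN [D * (_ / D)]mulrC divfK // -sumE mulr_sumr.
apply: eq_bigr => p _; rewrite list_eval_add plusE minusE.
rewrite (clear_denominator _ _ _ _ _ D0).
have e0 : list_eval qvar (0 :: c p) = qvar * list_eval qvar (c p) by exact: add0r.
rewrite !(fun_if (list_eval qvar)) list_eval_scale list_eval_add e0 mulN1r.
by congr (_ + _); case: ifP; rewrite ?mulr1 ?mulr0 ?oppr0.
Qed.

End RootPosets.

(* The coefficient at p is E6_coef`_p / E6_den, polynomials in q being listed from
   the constant term up, and rho = E6_const / E6_den; obtained by solving the
   linear system indexed by the 27 ideals, similarly for E7 with 56 ideals. *)
Definition E6_den : seq int := [:: 1; 1; 0; -1; 0; 1; 1].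
Definition E6_const : seq int := [:: 1; 1; 0; 0; 1; 1].
Definition E6_coef : seq (seq int) :=
 [:: [:: -1; -1; 0; 0; -1; -1]; [:: 0; -1; -1; -1; -1; -1]; [:: 0; 0; -1; -2; -2; -1];
     [:: 0; 0; 0; -1; -2; -1]; [:: 0; 0; 0; -1; -1; -1]; [:: 0; 0; 0; 0; -1; -1];
     [:: 1; 1; 0; -2; -2; -1]; [:: 1; 1; 0; -1; -1; -1]; [:: 0; 1; 1; -1; -2; -1];
     [:: 1; 2; 1; -1; -2; -1]; [:: 0; 0; 1; 0; -1; -1]; [:: 0; 1; 1; 0; -1; -1];
     [:: 1; 1; 1; 0; -1; -1]; [:: 1; 2; 2; 0; -1; -1]; [:: 0; 1; 2; 1; -1; -1];
     [:: 0; 0; 1; 1; 0; -1]].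
Definition E7_den : seq int := [:: 1; 1; 0; -1; -1; 0; 1; 1].
Definition E7_const : seq int := [:: 1; 1; 0; -1; 0; 1; 1].
Definition E7_coef : seq (seq int) :=
 [:: [:: -1; -1; 0; 1; 0; -1; -1]; [:: 0; -1; -1; 0; 0; -1; -1]; [:: 0; 0; -1; -1; -1; -1; -1];
     [:: 0; 0; 0; -1; -2; -2; -1]; [:: 0; 0; 0; 0; -1; -2; -1]; [:: 0; 0; 0; 0; -1; -1; -1];
     [:: 1; 1; 0; -1; -2; -2; -1]; [:: 0; 0; 0; 0; 0; -1; -1]; [:: 0; 1; 1; 0; -2; -2; -1];
     [:: 1; 1; 0; -1; -1; -1; -1]; [:: 0; 0; 1; 1; -1; -2; -1]; [:: 1; 2; 1; -1; -2; -2; -1];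
     [:: 0; 0; 0; 1; 0; -1; -1]; [:: 1; 1; 1; 0; -1; -2; -1]; [:: 0; 1; 1; 0; -1; -1; -1];
     [:: 1; 1; 0; 0; 0; -1; -1]; [:: 1; 2; 2; 0; -2; -2; -1]; [:: 1; 2; 1; 0; -1; -1; -1];
     [:: 0; 1; 2; 1; -1; -2; -1]; [:: 1; 2; 2; 1; -1; -2; -1]; [:: 0; 0; 1; 1; 0; -1; -1];
     [:: 0; 1; 1; 1; 0; -1; -1]; [:: 1; 1; 1; 1; 0; -1; -1]; [:: 1; 2; 2; 1; 0; -1; -1];
     [:: 0; 1; 2; 2; 0; -1; -1]; [:: 0; 0; 1; 2; 1; -1; -1]; [:: 0; 0; 0; 1; 1; 0; -1]].

(** The rank of a root is its height minus one, as the minimal element is a simple root. The highest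
    root has height 11 here and 17 for $E_7$, whence the maximal ranks 10 and 16. *)
Lemma E6_antichain : antichain_qconstant E6_le.
Proof.
apply: (list_toggle 16 (fun i j => all2 leq (nth [::] E6_roots i) (nth [::] E6_roots j))
  (fun p => (sumn (nth [::] E6_roots p)).-1) 10 (nth [::] E6_coef) E6_den E6_const);
  by vm_compute.
Qed.

Lemma E7_antichain : antichain_qconstant E7_le.
Proof.
apply: (list_toggle 27 (fun i j => all2 leq (nth [::] E7_roots i) (nth [::] E7_roots j))
  (fun p => (sumn (nth [::] E7_roots p)).-1) 16 (nth [::] E7_coef) E7_den E7_const);
  by vm_compute.
Qed.

Theorem theorem5p16 (T : finType) (le : rel T) :
  minuscule le ->
  qequiv le (fun I => \sum_(p : T) Tminus le p I)
            (fun _ => (\sum_(p : T) qvar ^+ rk le p) / qint (rkP le + 2)).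
Proof.
rewrite -/(antichain_qconstant le).
case=> [[a [b [a0 b0 [f [f_bij fE]]]]]|[[n [n0 [f [f_bij fE]]]]|
  [[n [n2 [f [f_bij fE]]]]|[[f [f_bij fE]]|[f [f_bij fE]]]]]];
  apply: (antichain_qconstant_iso f f_bij fE).
- exact: rect_antichain.
- exact: stair_antichain.
- case: n n2 f {f_bij fE} => [|[|t]] // _ _; exact: dtd_antichain.
- exact: E6_antichain.
- exact: E7_antichain.
Qed.
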